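(* Let $\tau\in(0,1)$, $\tau\ne1/2$, $q_0=1/2$, $q_1=\tau$, and for $\ell,m\in\{0,1\}$ let $c_{\ell m}=\max\{q_\ell,1-q_m\}$. If $\theta=(b_0,b_1,r)\in\Theta_I^{0,\tau}$, then for every $\ell,m\in\{0,1\}$, every $s,t\in\{1,\dots,T\}$, every $v\in\mathbb R$, and $P_X$-almost every $x$, $$P^{\mathrm{obs}}\{Z_{\ell s}(\theta)\le v<Z_{mt}(\theta)\mid X=x\}\le c_{\ell m}.$$ (When $\ell=m$ the restriction is nontrivial only for $s\ne t$; when $\ell\ne m$ it also applies with $s=t$.)
   Context: $T,k\ge1$ are integers. $P^{\mathrm{obs}}$ is a Borel probability law of $(Y,X)$, $Y\in\mathbb R^T$, $X=(X_1,\dots,X_T)$, $X_t\in\mathbb R^k$; $P_X$ is the law of $X$. For $\theta=(b_0,b_1,r)\in\mathbb R^k\times\mathbb R^k\times(0,\infty)$, $Z_{0t}(\theta)=Y_t-X_t'b_0$ and $Z_{1t}(\theta)=(Y_t-X_t'b_1)/r$. $\Theta_I^{0,\tau}$ is the set of such $\theta$ (with $r>0$) for which there is a Borel probability law $\pi$ of $(Y,X,A)$, $A\in\mathbb R$, with $(Y,X)$-marginal $P^{\mathrm{obs}}$, such that $\pi$-a.s., for $\ell=0,1$ and all $t\le T$, $\pi\{Z_{\ell t}(\theta)\le A\mid X,A\}\ge q_\ell$ and $\pi\{Z_{\ell t}(\theta)<A\mid X,A\}\le q_\ell$. *)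

(* Defs.v *)
From HB Require Import structures.
From mathcomp Require Import all_boot all_order all_algebra.
From mathcomp Require Import all_classical all_reals all_analysis.

Set Implicit Arguments.
Unset Strict Implicit.
Unset Printing Implicit Defensive.

Import Order.TTheory GRing.Theory Num.Theory.
Import numFieldNormedType.Exports.

Local Open Scope classical_set_scope.
Local Open Scope ring_scope.

Section conditional_probability.
Context d d' (Omega : measurableType d) (S : measurableType d') (R : realType).
Implicit Types (P : probability Omega R) (W : {mfun Omega >-> S}).

(* [g] is a version of the conditional probability w |-> P{E | W = w}, in
   Kolmogorov's sense. *)
Definition is_cond_prob P W (E : set Omega) (g : S -> R) : Prop :=
  (distribution P W).-integrable [set: S] (EFin \o g) /\
  forall B : set S, measurable B ->
    (\int[distribution P W]_(w in B) (g w)%:E = P (E `&` W @^-1` B))%E.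

(* A fixed version of P{E | W = w}. By [cond_probP] and [cond_prob_unique]
   below, it exists for every event E and all versions agree almost surely, so
   statements about almost every w do not depend on the choice. *)
Definition cond_prob P W (E : set Omega) : S -> R :=
  xget (cst 0) [set g | is_cond_prob P W E g].

Lemma cond_probP P W (E : set Omega) :
  measurable E -> is_cond_prob P W E (cond_prob P W E).
Proof.
move=> mE.
suff [g gP] : exists g, is_cond_prob P W E g by exact: (xgetI (cst 0) gP).
have PEoo : (P E < +oo)%E by rewrite -ge0_fin_numE// fin_num_measure.
have mWB B : measurable B -> measurable (W @^-1` B).
  by move=> mB; exact: measurable_funPTI.
have [nu nuE] : exists nu : {charge set S -> \bar R},
    forall B, nu B = P (W @^-1` B `&` E).
  pose nu0 := charge_of_finite_measure (mfrestr mE PEoo).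
  unshelve refine (ex_intro _ (pushforward nu0 W : {charge set S -> \bar R}) _).
    exact: measurable_funPT.
  by [].
have numu : nu `<< distribution P W.
  apply/null_content_dominatesP => B mB PB0; apply/eqP.
  rewrite eq_le nuE measure_ge0 andbT -[X in (_ <= X)%E]PB0.
  apply: le_measure; rewrite ?inE; [|exact: mWB|exact: subIsetl].
  by apply: measurableI => //; exact: mWB.
exists (fine \o Radon_Nikodym nu (distribution P W)).
have fE : EFin \o (fine \o Radon_Nikodym nu (distribution P W)) =
    Radon_Nikodym nu (distribution P W).
  by apply/funext => w /=; rewrite fineK// Radon_Nikodym_fin_num.
split=> [|B mB]; first by rewrite fE; exact: Radon_Nikodym_integrable.
rewrite -[X in integral _ _ X]/(EFin \o (fine \o _)) fE.
by rewrite -Radon_Nikodym_integral// nuE setIC.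
Qed.

Lemma cond_prob_unique P W (E : set Omega) (g h : S -> R) :
  is_cond_prob P W E g -> is_cond_prob P W E h ->
  {ae distribution P W, forall w, g w = h w}.
Proof.
move=> [ig gE] [ih hE].
have /(_ ig (measurable_int _ ih)) gh := @integral_ae_eq _ S R
  (distribution P W) setT measurableT (EFin \o h) (EFin \o g).
have : ae_eq (distribution P W) setT (EFin \o g) (EFin \o h).
  by apply: gh => B _ mB; rewrite gE// hE.
by apply: filterS => w /(_ I) [].
Qed.

End conditional_probability.

Section model.
Variables (R : realType) (T k : nat).

(* Tuples carry the product sigma-algebra, i.e. the Borel one, so that the
   points (y, x) below range over R^T x (R^k)^T. *)
Local Notation regressors := (T.-tuple (k.-tuple R)).
Local Notation observables := (T.-tuple R * regressors)%type.

(* theta = (b0, b1, r) *)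
Local Notation parameter := (k.-tuple R * k.-tuple R * R)%type.

Definition dot (u b : k.-tuple R) : R := \sum_(j < k) tnth u j * tnth b j.

(* Z_{lt}(theta), with l = 0, 1 encoded as false, true *)
Definition Z (theta : parameter) (l : bool) (t : 'I_T) (yx : observables) : R :=
  let: (b0, b1, r) := theta in
  if l then (tnth yx.1 t - dot (tnth yx.2 t) b1) / r
  else tnth yx.1 t - dot (tnth yx.2 t) b0.

Lemma measurable_Z (theta : parameter) (l : bool) (t : 'I_T) :
  measurable_fun [set: observables] (Z theta l t).
Proof.
have mY : measurable_fun [set: observables] (fun yx => tnth yx.1 t).
  by apply: (measurableT_comp (measurable_tnth t)); exact: measurable_fst.
have mdot b : measurable_fun [set: observables] (fun yx => dot (tnth yx.2 t) b).
  apply: measurable_sum => j; apply: measurable_realfun.measurable_funM => //.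
  apply: (measurableT_comp (measurable_tnth j)).
  by apply: (measurableT_comp (measurable_tnth t)); exact: measurable_snd.
case: theta => -[b0 b1] r; rewrite /Z; case: l; last exact: measurable_realfun.measurable_funB.
by apply: measurable_realfun.measurable_funM => //; exact: measurable_realfun.measurable_funB.
Qed.

Definition q (tau : R) (l : bool) : R := if l then tau else 2^-1.

Definition c (tau : R) (l m : bool) : R := Num.max (q tau l) (1 - q tau m).

Definition obsX (yx : observables) : regressors := yx.2.

Lemma measurable_obsX : measurable_fun [set: observables] obsX.
Proof. exact: measurable_snd. Qed.

HB.instance Definition _ := isMeasurableFun.Build _ _ _ _ obsX measurable_obsX.

(* Coordinates on the space of triples (Y, X, A), encoded as ((y, x), a) *)
Definition latYX (w : observables * R) : observables := w.1.

Definition latXA (w : observables * R) : regressors * R := (w.1.2, w.2).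

Lemma measurable_latYX : measurable_fun [set: observables * R] latYX.
Proof. exact: measurable_fst. Qed.

HB.instance Definition _ := isMeasurableFun.Build _ _ _ _ latYX measurable_latYX.

Lemma measurable_latXA : measurable_fun [set: observables * R] latXA.
Proof.
apply: measurable_fun_pair; last exact: measurable_snd.
by apply: (measurableT_comp measurable_snd); exact: measurable_fst.
Qed.

HB.instance Definition _ := isMeasurableFun.Build _ _ _ _ latXA measurable_latXA.

Definition identified_set (tau : R) (Pobs : probability observables R) :
    set parameter :=
  [set theta | 0 < theta.2 /\
    exists pi : probability (observables * R)%type R,
      (forall B : set observables, measurable B ->
         distribution pi latYX B = Pobs B) /\
      {ae pi, forall w, forall (l : bool) (t : 'I_T),
         q tau l <= cond_prob pi latXA
                      [set w' | Z theta l t (latYX w') <= w'.2] (latXA w) /\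
         cond_prob pi latXA
           [set w' | Z theta l t (latYX w') < w'.2] (latXA w) <= q tau l}].

End model.

(* Main.v *)
Require Import Defs.
From HB Require Import structures.
From mathcomp Require Import all_boot all_order all_algebra.
From mathcomp Require Import all_classical all_reals all_analysis.
From mathcomp Require Import measurable_realfun.

(** Condition on [(X, A)] under a latent law. If [v < A], then
    [Z_l <= v < Z_m] forces [Z_l < A], which has conditional probability at most
    [q_l]; if [A <= v], it forces [A < Z_m], the complement of [Z_m <= A], which
    has conditional probability at most [1 - q_m]. Integrating the resulting
    bound over [X \in B] for every [B] gives the bound given [X] alone. *)

Set Implicit Arguments.
Unset Strict Implicit.
Unset Printing Implicit Defensive.

Import Order.TTheory GRing.Theory Num.Theory.
Import numFieldNormedType.Exports.

Local Open Scope classical_set_scope.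
Local Open Scope ring_scope.

Section comparison_sets.
Context d (T : measurableType d) (R : realType).
Implicit Types f g : T -> R.

Lemma measurable_ler f g : measurable_fun setT f -> measurable_fun setT g ->
  measurable [set x | f x <= g x].
Proof.
by move=> mf mg; rewrite -[X in measurable X]setTI; exact: measurable_fun_le.
Qed.

Lemma measurable_ltr f g : measurable_fun setT f -> measurable_fun setT g ->
  measurable [set x | f x < g x].
Proof.
move=> mf mg; under eq_set do rewrite -lte_fin.
rewrite -[X in measurable X]setTI.
by apply: measurable_lte => //; exact/measurable_EFinP.
Qed.

End comparison_sets.

Section ae_comparison.
Context d (T : measurableType d) (R : realType).
Variable mu : {measure set T -> \bar R}.
Local Open Scope ereal_scope.

(** Deleting from [D] a measurable null set [N] that covers the exceptional points changes neither
    integral, and on what is left the comparison is pointwise. *)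
Lemma ae_le_integral (D : set T) (f g : T -> \bar R) :
  measurable D -> mu.-integrable D f -> mu.-integrable D g ->
  {ae mu, forall x, D x -> f x <= g x} ->
  \int[mu]_(x in D) f x <= \int[mu]_(x in D) g x.
Proof.
move=> mD fi gi [N [mN N0 fgN]].
rewrite (negligible_integral mN mD fi N0) (negligible_integral mN mD gi N0).
have mDN : measurable (D `\` N) by exact: measurableD.
apply: le_integral => //; try exact: (integrableS mD).
move=> x; rewrite inE => -[Dx Nx].
by apply: contrapT => fg; apply/Nx/fgN => /= /(_ Dx).
Qed.

(** Test the hypothesis on [B], the set where the conclusion fails: there [f - g] is positive but
    has integral at most 0, so it vanishes almost everywhere on [B], which forces [B] to be null. *)
Lemma integral_le_ae (f g : T -> R) :
  mu.-integrable setT (EFin \o f) -> mu.-integrable setT (EFin \o g) ->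
  (forall B, measurable B ->
    \int[mu]_(x in B) (f x)%:E <= \int[mu]_(x in B) (g x)%:E) ->
  {ae mu, forall x, (f x <= g x)%R}.
Proof.
move=> fi gi fg; pose B := [set x | (g x < f x)%R].
have mf : measurable_fun setT f by exact/measurable_EFinP/(measurable_int _ fi).
have mg : measurable_fun setT g by exact/measurable_EFinP/(measurable_int _ gi).
have mB : measurable B by exact: measurable_ltr.
have Bi (h : T -> \bar R) : mu.-integrable setT h -> mu.-integrable B h.
  by move=> hi; exact: (integrableS measurableT).
have fgB0 : \int[mu]_(x in B) `|((f x)%:E - (g x)%:E)| = 0.
  under eq_integral => x.
    rewrite inE => Bx; rewrite gee0_abs; last first.
      by rewrite -EFinB lee_fin subr_ge0 ltW.
  over.
  apply/eqP; rewrite eq_le; apply/andP; split; last first.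
    by apply: integral_ge0 => x Bx; rewrite -EFinB lee_fin subr_ge0 ltW.
  rewrite integralB_EFin//; try exact: Bi.
  (* Moving the subtracted integral across the inequality in [\bar R] requires it to be finite,
     which integrability of [g] supplies. *)
  rewrite leeBlDr ?add0e; first exact: fg.
  exact: (integrable_fin_num mB (f := EFin \o g) (Bi _ gi)).
have mfgB : measurable_fun B (fun x => (f x)%:E - (g x)%:E).
  by apply: emeasurable_funB; apply/measurable_EFinP/measurable_funTS.
have /(_ fgB0) := (ae_eq_integral_abs mu mB mfgB).1.
apply: filterS => x fgx; rewrite leNgt; apply/negP => gf.
have /eqP := fgx gf.
by rewrite -EFinB eqe subr_eq0 (gt_eqF gf).
Qed.

End ae_comparison.

Section cond_prob_bounds.
Context d d' (Omega : measurableType d) (S : measurableType d') (R : realType).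
Variables (P : probability Omega R) (W : {mfun Omega >-> S}).
Local Open Scope ereal_scope.

(** The hypotheses of the identified set are almost sure under the joint law, while integrals of
    versions are taken under the law of [W]; measurability of [A] lets its complement serve as the
    null set. *)
Lemma ae_distribution (A : set S) : measurable A ->
  {ae P, forall w, A (W w)} -> {ae distribution P W, forall x, A x}.
Proof.
move=> mA PA.
have mAC : measurable (~` A) by exact: measurableC.
exists (~` A); split => //.
rewrite /distribution /pushforward; apply: measure_negligible => //.
by apply: measurable_funPTI.
Qed.

(** The defining identity of a version turns the hypothesis into a comparison of integrals with the
    constant [M] over every [B]. *)
Lemma cond_prob_le_ae (E : set Omega) (M : R) : measurable E ->
  (forall B, measurable B -> P (E `&` W @^-1` B) <= M%:E * P (W @^-1` B)) ->
  {ae distribution P W, forall x, (cond_prob P W E x <= M)%R}.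
Proof.
move=> /(cond_probP P W)[gi gE] EM.
apply: (integral_le_ae (g := cst M)) gi _ _.
  exact: finite_measure_integrable_cst.
move=> B mB; rewrite gE//; apply: le_trans (EM _ mB) _.
by rewrite -[X in X <= _](integral_cst (distribution P W) mB).
Qed.

Lemma le_cond_prob_setI (E : set Omega) (M : R) (B : set S) :
  measurable E -> measurable B ->
  {ae P, forall w, (cond_prob P W E (W w) <= M)%R} ->
  P (E `&` W @^-1` B) <= M%:E * P (W @^-1` B).
Proof.
move=> /(cond_probP P W)[gi gE] mB gM.
have mg : measurable_fun setT (cond_prob P W E).
  exact/measurable_EFinP/(measurable_int _ gi).
rewrite -gE// -[leRHS](integral_cst (distribution P W) mB).
apply: ae_le_integral => //.
- exact: (integrableS measurableT).
- exact: (finite_measure_integrable_cst (distribution P W) M mB).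
- have : {ae distribution P W, forall x, (cond_prob P W E x <= M)%R}.
    apply: ae_distribution gM; exact: (measurable_ler mg (measurable_cst M)).
  by apply: filterS => x + _; rewrite lee_fin.
Qed.

Lemma ge_cond_prob_setI (E : set Omega) (M : R) (B : set S) :
  measurable E -> measurable B ->
  {ae P, forall w, (M <= cond_prob P W E (W w))%R} ->
  M%:E * P (W @^-1` B) <= P (E `&` W @^-1` B).
Proof.
move=> /(cond_probP P W)[gi gE] mB gM.
have mg : measurable_fun setT (cond_prob P W E).
  exact/measurable_EFinP/(measurable_int _ gi).
rewrite -gE// -[leLHS](integral_cst (distribution P W) mB).
apply: ae_le_integral => //.
- exact: (finite_measure_integrable_cst (distribution P W) M mB).
- exact: (integrableS measurableT).
- have : {ae distribution P W, forall x, (M <= cond_prob P W E x)%R}.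
    apply: ae_distribution gM; exact: (measurable_ler (measurable_cst M) mg).
  by apply: filterS => x + _; rewrite lee_fin.
Qed.

(** Complements are taken in the integrated inequality, by subtracting from [P (W @^-1]
    B)[, so no version for]~[E] has to be related to the one for [E]. *)
Lemma cond_prob_setC_setI (E : set Omega) (M : R) (B : set S) :
  measurable E -> measurable B ->
  {ae P, forall w, (M <= cond_prob P W E (W w))%R} ->
  P (~` E `&` W @^-1` B) <= (1 - M)%:E * P (W @^-1` B).
Proof.
move=> mE mB gM.
have mWB : measurable (W @^-1` B) by exact: measurable_funPTI.
have := ge_cond_prob_setI mE mB gM.
have -> : ~` E `&` W @^-1` B = W @^-1` B `\` E by rewrite setDE setIC.
have EB_fin : P (W @^-1` B `&` E) \is a fin_num.
  by apply: fin_num_measure; exact: measurableI.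
have -> : P (W @^-1` B `\` E) = P (W @^-1` B) - P (W @^-1` B `&` E).
  by rewrite measureD// -ge0_fin_numE// fin_num_measure.
rewrite setIC -(fineK EB_fin) -[P (W @^-1` B)]fineK ?fin_num_measure//.
rewrite -EFinM -EFinB -EFinM !lee_fin mulrBl mul1r => MB.
by rewrite lerD2l lerN2.
Qed.

End cond_prob_bounds.

Theorem proposition8p4 (R : realType) (T k : nat) (hT : (1 <= T)%N)
    (hk : (1 <= k)%N)
    (Pobs : probability (T.-tuple R * T.-tuple (k.-tuple R))%type R)
    (tau : R) (tau_gt0 : 0 < tau) (tau_lt1 : tau < 1) (tau_neq : tau != 2^-1)
    (b0 b1 : k.-tuple R) (r : R)
    (theta_in : identified_set tau Pobs (b0, b1, r)) :
  forall (l m : bool) (s t : 'I_T) (v : R),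
    {ae distribution Pobs (@obsX R T k), forall x,
       cond_prob Pobs (@obsX R T k)
         [set yx | Z (b0, b1, r) l s yx <= v < Z (b0, b1, r) m t yx] x
       <= c tau l m}.
Proof.
case: theta_in => _ [pi [piE piq]] l m s t v.
set theta := (b0, b1, r) in piq *.
set E := [set yx | _].
have mZ i j := @measurable_Z R T k theta i j.
have mE : measurable E.
  rewrite (_ : E = [set yx | Z theta l s yx <= v] `&`
                   [set yx | v < Z theta m t yx]); last first.
    by apply/seteqP; split => yx /=; [move/andP | move=> h; apply/andP].
  apply: measurableI.
  - exact: (measurable_ler (mZ l s) (measurable_cst v)).
  - exact: (measurable_ltr (measurable_cst v) (mZ m t)).
have mZA i j : measurable_fun setT (fun w => Z theta i j (@latYX R T k w)).
  exact: (measurableT_comp (mZ i j) (@measurable_latYX R T k)).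
pose L := [set w' | Z theta l s (@latYX R T k w') < w'.2].
pose G := [set w' | Z theta m t (@latYX R T k w') <= w'.2].
have mL : measurable L by exact: (measurable_ltr (mZA l s) measurable_snd).
have mG : measurable G by exact: (measurable_ler (mZA m t) measurable_snd).
(* It remains to bound the joint probability of [E] and X in [B] by [c tau l m] times that of X in
   [B]. Both events involve (Y, X) only, so they can be measured under [pi]. *)
apply: cond_prob_le_ae => // B mB.
have mXB : measurable (@obsX R T k @^-1` B) by exact: measurable_funPTI.
have mEB : measurable (E `&` @obsX R T k @^-1` B) by exact: measurableI.
rewrite -(piE _ mXB) -(piE _ mEB) /distribution /pushforward.
(* Splitting at A = v is an event in (X, A), so each conditional bound can be integrated over its
   own half. The tie A = v belongs to the lower half: both [v < A] with [Z_l <= v] and [A <= v] with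
   [v < Z_m] then give strict comparisons with A. *)
pose Bhi := B `*` `]v, +oo[%classic.
pose Blo := B `*` `]-oo, v]%classic.
have mBhi : measurable Bhi by apply: measurableX.
have mBlo : measurable Blo by apply: measurableX.
have mhi : measurable (@latXA R T k @^-1` Bhi) by exact: measurable_funPTI.
have mlo : measurable (@latXA R T k @^-1` Blo) by exact: measurable_funPTI.
have BhiU : @latYX R T k @^-1` (@obsX R T k @^-1` B) =
    @latXA R T k @^-1` Bhi `|` @latXA R T k @^-1` Blo.
  apply/seteqP; split => [w /= Bw|w [] [] //].
  have [vw|wv] := ltP v w.2; [left|right]; split => //=;
    by rewrite in_itv/= ?andbT.
have hilo0 : [disjoint @latXA R T k @^-1` Bhi & @latXA R T k @^-1` Blo].
  apply/disj_setPS => w [[_ /=]] + [_ /=].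
  by rewrite !in_itv/= andbT ltNge => /negP.
have Lhi : (pi (L `&` @latXA R T k @^-1` Bhi) <=
    (q tau l)%:E * pi (@latXA R T k @^-1` Bhi))%E.
  by apply: le_cond_prob_setI => //; apply: filterS piq => w /(_ l s)[].
have Glo : (pi (~` G `&` @latXA R T k @^-1` Blo) <=
    (1 - q tau m)%:E * pi (@latXA R T k @^-1` Blo))%E.
  by apply: cond_prob_setC_setI => //; apply: filterS piq => w /(_ m t)[].
rewrite BhiU measureU//; last exact/disj_set2P.
rewrite ge0_muleDr//.
apply: (@le_trans _ _ (pi (L `&` @latXA R T k @^-1` Bhi) +
    pi (~` G `&` @latXA R T k @^-1` Blo))%E).
  apply: (le_trans _ (measureU2 _ _ _)).
  - apply: le_measure; rewrite ?inE.
    + exact: (@measurable_funPTI _ _ _ _ (@latYX R T k)).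
    + by apply: measurableU; apply: measurableI => //; exact: measurableC.
    move=> w /= [/andP[Zv vZ] Bw].
    have [vw|wv] := ltP v w.2; [left|right]; split.
    + exact: le_lt_trans Zv vw.
    + by split => //=; rewrite in_itv/= andbT.
    + by apply/negP; rewrite -ltNge; exact: le_lt_trans wv vZ.
    + by split => //=; rewrite in_itv.
  - exact: measurableI.
  - by apply: measurableI => //; exact: measurableC.
(* The two halves carry the constants [q tau l] and [1 - q tau m]; the maximum [c tau l m] dominates
   both. *)
apply: leeD.
- apply: (le_trans Lhi); apply: lee_wpmul2r => //.
  by rewrite lee_fin /c le_max lexx.
- apply: (le_trans Glo); apply: lee_wpmul2r => //.
  by rewrite lee_fin /c le_max lexx orbT.
Qed.
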